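(* Let $p$ be an odd prime, and let $T$ and $U$ be pruned trees on $\mathbb{N}$ such that $T_1$ and $U_1$ are infinite. Then $[T]$ and $[U]$ are uniformly homeomorphic if and only if $G_T$ is topologically isomorphic to $G_U$.
   Context: A tree on $\mathbb{N}$ is a nonempty $T\subseteq\mathbb{N}^{<\mathbb{N}}$ closed under initial segments; pruned means each node has a proper extension in $T$. $[T]$ is the set of $x\in\mathbb{N}^{\mathbb{N}}$ with all initial segments in $T$, with the ultrametric $d(x,y)=2^{-n}$, $n$ least with $x(n)\ne y(n)$; uniformly homeomorphic means there is a bijection which together with its inverse is uniformly continuous. $T_n=\{s\in T:|s|=n\}$ and $p_n\colon T_{n+1}\to T_n$ is the predecessor map $s\mapsto s\upharpoonright n$ (surjective, since $T$ is pruned). For a countably infinite set $X$, $L(X)=N(X)/\langle\{[a_v,b_v]:v\in X\}\rangle$ where $N(X)$ is the free nilpotent group of class $2$ and exponent $p$ on free generators $\{a_v,b_v:v\in X\}$; a surjection $q\colon X\to Y$ induces the epimorphism $\widehat q\colon L(X)\to L(Y)$, $a_v\mapsto a_{q(v)}$, $b_v\mapsto b_{q(v)}$. $G_T$ is the inverse limit $\varprojlim_{n\in\mathbb{N}}(L(T_{n+1}),\widehat p_{n+1})$, i.e. the closed subgroup $\{x\in\prod_n L(T_{n+1}):\forall n\ \widehat p_{n+1}(x(n+1))=x(n)\}$ of the product of the discrete groups $L(T_{n+1})$; $G_U$ is defined likewise. *)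

(* Defs.v *)
From HB Require Import structures.
From mathcomp Require Import all_boot all_order all_algebra.
From mathcomp Require Import generic_quotient monoid.
From mathcomp Require Import all_classical all_reals topology.

Set Implicit Arguments.
Unset Strict Implicit.
Unset Printing Implicit Defensive.

Import Order.TTheory GRing.Theory Num.Theory.

Local Open Scope classical_set_scope.
Local Open Scope quotient_scope.

Inductive gterm (A : Type) :=
  | GVar of A
  | GOne
  | GMul of gterm A & gterm A
  | GInv of gterm A.
Arguments GOne {A}.

HB.instance Definition _ (A : Type) := gen_eqMixin (gterm A).
HB.instance Definition _ (A : Type) := gen_choiceMixin (gterm A).

Section GtermOps.
Variable A : Type.
Implicit Types s t : gterm A.

Definition gterm_exp s n := iterop n (@GMul A) s GOne.

Definition gterm_comm s t := GMul (GInv s) (GMul (GInv t) (GMul s t)).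

End GtermOps.

(* Terms are related iff they agree under every assignment in every group
   satisfying x ^ p = 1 and [[x, y], z] = 1, so the quotient is the relatively
   free group of that variety; see [nil2_lift_gen] and [nil2_lift_uniq]. *)
Inductive nil2_eq (p : nat) (A : Type) : gterm A -> gterm A -> Prop :=
  | nil2_refl s : nil2_eq p s s
  | nil2_sym s t : nil2_eq p s t -> nil2_eq p t s
  | nil2_trans s t u : nil2_eq p s t -> nil2_eq p t u -> nil2_eq p s u
  | nil2_congM s s' t t' : nil2_eq p s s' -> nil2_eq p t t' ->
      nil2_eq p (GMul s t) (GMul s' t')
  | nil2_congV s s' : nil2_eq p s s' -> nil2_eq p (GInv s) (GInv s')
  | nil2_mulA s t u : nil2_eq p (GMul s (GMul t u)) (GMul (GMul s t) u)
  | nil2_mul1g s : nil2_eq p (GMul GOne s) s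
  | nil2_mulg1 s : nil2_eq p (GMul s GOne) s
  | nil2_mulVg s : nil2_eq p (GMul (GInv s) s) GOne
  | nil2_mulgV s : nil2_eq p (GMul s (GInv s)) GOne
  | nil2_exp s : nil2_eq p (gterm_exp s p) GOne
  | nil2_comm3 s t u : nil2_eq p (gterm_comm (gterm_comm s t) u) GOne.

Section Nil2.
Variables (p : nat) (A : Type).

Definition nil2_rel : rel (gterm A) := fun s t => `[< nil2_eq p s t >].

Lemma nil2_rel_refl : reflexive nil2_rel.
Proof. by move=> s; apply/asboolP/nil2_refl. Qed.

Lemma nil2_rel_sym : symmetric nil2_rel.
Proof. by move=> s t; apply/asboolP/asboolP; exact: nil2_sym. Qed.

Lemma nil2_rel_trans : transitive nil2_rel.
Proof. by move=> t s u /asboolP st /asboolP tu; apply/asboolP/(nil2_trans st). Qed.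

Canonical nil2_equiv := EquivRel nil2_rel nil2_rel_refl nil2_rel_sym nil2_rel_trans.

Definition nil2 : Type := {eq_quot nil2_equiv}.

HB.instance Definition _ := Choice.on nil2.
HB.instance Definition _ := EqQuotient.on nil2.

Lemma nil2_piP s t : \pi_nil2 s = \pi_nil2 t <-> nil2_eq p s t.
Proof.
by split=> [/eqquotP/asboolP//|st]; apply/eqquotP/asboolP.
Qed.

Definition nil2_mul (x y : nil2) : nil2 := \pi_nil2 (GMul (repr x) (repr y)).
Definition nil2_one : nil2 := \pi_nil2 GOne.
Definition nil2_inv (x : nil2) : nil2 := \pi_nil2 (GInv (repr x)).

Lemma nil2_repr s : nil2_eq p (repr (\pi_nil2 s)) s.
Proof. by apply/nil2_piP; rewrite reprK. Qed.

Lemma nil2_piM s t : nil2_mul (\pi s) (\pi t) = \pi_nil2 (GMul s t).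
Proof. by apply/nil2_piP/nil2_congM; exact: nil2_repr. Qed.

Lemma nil2_piV s : nil2_inv (\pi s) = \pi_nil2 (GInv s).
Proof. by apply/nil2_piP/nil2_congV; exact: nil2_repr. Qed.

Let mulA : associative nil2_mul.
Proof.
move=> x y z; rewrite -[x]reprK -[y]reprK -[z]reprK !nil2_piM.
exact/nil2_piP/nil2_mulA.
Qed.

Let mul1g : left_id nil2_one nil2_mul.
Proof.
by move=> x; rewrite -[x]reprK /nil2_one nil2_piM; apply/nil2_piP/nil2_mul1g.
Qed.

Let mulg1 : right_id nil2_one nil2_mul.
Proof.
by move=> x; rewrite -[x]reprK /nil2_one nil2_piM; apply/nil2_piP/nil2_mulg1.
Qed.

Let mulVg : left_inverse nil2_one nil2_inv nil2_mul.
Proof.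
by move=> x; rewrite -[x]reprK nil2_piV nil2_piM; apply/nil2_piP/nil2_mulVg.
Qed.

Let mulgV : right_inverse nil2_one nil2_inv nil2_mul.
Proof.
by move=> x; rewrite -[x]reprK nil2_piV nil2_piM; apply/nil2_piP/nil2_mulgV.
Qed.

HB.instance Definition _ := isGroup.Build nil2 mulA mul1g mulg1 mulVg mulgV.

Definition nil2_gen (a : A) : nil2 := \pi_nil2 (GVar a).

End Nil2.

Definition in_nil2_variety (p : nat) (G : groupType) : Prop :=
  (forall x : G, x ^+ p = 1)%g /\ (forall x y z : G, [~ x, y, z] = 1)%g.

Lemma nil2_variety p A : in_nil2_variety p (nil2 p A).
Proof.
have expE s n : (\pi_(nil2 p A) s ^+ n)%g = \pi_(nil2 p A) (gterm_exp s n).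
  case: n => [|n]; first exact: erefl.
  elim: n => [|n IH]; first exact: erefl.
  by rewrite expgS IH; exact: nil2_piM.
have commE s t :
    [~ \pi_(nil2 p A) s, \pi_(nil2 p A) t]%g = \pi_(nil2 p A) (gterm_comm s t).
  have V u : (\pi_(nil2 p A) u)^-1%g = \pi_(nil2 p A) (GInv u) by exact: nil2_piV.
  have M u v : (\pi_(nil2 p A) u * \pi_(nil2 p A) v)%g = \pi_(nil2 p A) (GMul u v).
    exact: nil2_piM.
  by rewrite /gterm_comm -!(V, M).
split=> [x|x y z]; first by rewrite -[x]reprK expE; exact/nil2_piP/nil2_exp.
rewrite -[x]reprK -[y]reprK -[z]reprK (commE (repr x)) (commE (gterm_comm _ _)).
exact/nil2_piP/nil2_comm3.
Qed.

Section Nil2Lift.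
Variables (p : nat) (A : Type) (G : groupType) (f : A -> G).

Fixpoint gterm_eval (s : gterm A) : G :=
  match s with
  | GVar a => f a
  | GOne => 1
  | GMul s t => gterm_eval s * gterm_eval t
  | GInv s => (gterm_eval s)^-1
  end%g.

Definition nil2_lift (x : nil2 p A) : G := gterm_eval (repr x).

Hypothesis GP : in_nil2_variety p G.

Lemma nil2_eval s t : nil2_eq p s t -> gterm_eval s = gterm_eval t.
Proof.
have [G1 G2] := GP.
elim=> //= [? ? ? _ -> _ ->|? ? ? ? _ -> _ ->|? ? _ ->|? ? ?|?|?|?|?|{}s|? ? ?] //.
- by rewrite mulgA.
- by rewrite mul1g.
- by rewrite mulg1.
- by rewrite mulVg.
- by rewrite mulgV.
- rewrite -[RHS](G1 (gterm_eval s)).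
  case: p => [|n]; first exact: erefl.
  elim: n => [|n IH]; first exact: erefl.
  by rewrite expgS -IH.
- exact: G2.
Qed.

Lemma nil2_lift_gen a : nil2_lift (nil2_gen p a) = f a.
Proof. by rewrite /nil2_lift (nil2_eval (nil2_repr p _)). Qed.

Lemma nil2_liftM : {morph nil2_lift : x y / x * y >-> x * y}%g.
Proof. by move=> x y; rewrite /nil2_lift (nil2_eval (nil2_repr p _)). Qed.

Lemma nil2_lift_uniq (h : {multiplicative nil2 p A -> G}) :
  (forall a, h (nil2_gen p a) = f a) -> h =1 nil2_lift.
Proof.
move=> hf x; have h1 : h 1%g = 1%g by apply: (@mulgI _ (h 1%g)); rewrite -gmulfM !mulg1.
rewrite -[x]reprK /nil2_lift (nil2_eval (nil2_repr p _)).
elim: (repr x) => [a||s IHs t IHt|s IHs] /=; first exact: hf.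
- exact: h1.
- by rewrite -IHs -IHt -gmulfM; congr (h _); exact/esym/nil2_piM.
- apply: (@mulgI _ (h (\pi s))); rewrite -IHs mulgV -gmulfM -[RHS]h1.
  by rewrite -(nil2_piV p s); congr (h _); exact: mulgV.
Qed.

End Nil2Lift.

Definition is_subgroup (G : groupType) (H : set G) : Prop :=
  H 1%g /\ forall x y, H x -> H y -> H (x / y)%g.

Definition subgroup_gen (G : groupType) (S : set G) : set G :=
  smallest (@is_subgroup G) S.

Record normal_subgroup (G : groupType) := NormalSubgroup {
  normal_set : set G;
  normal_is_subgroup : is_subgroup normal_set;
  normal_conj : forall x y, normal_set x -> normal_set (x ^ y)%g }.

Section QuotientGroup.
Variables (G : groupType) (N : normal_subgroup G).

Let N1 : normal_set N 1%g. Proof. by have [] := normal_is_subgroup N. Qed.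
Let NF x y : normal_set N x -> normal_set N y -> normal_set N (x / y)%g.
Proof. by have [_] := normal_is_subgroup N; apply. Qed.
Let NV x : normal_set N x -> normal_set N x^-1%g.
Proof. by move=> Nx; rewrite -div1g; exact: NF. Qed.
Let NM x y : normal_set N x -> normal_set N y -> normal_set N (x * y)%g.
Proof. by move=> Nx /NV Ny; rewrite -[y]invgK; exact: NF. Qed.

Definition coset_rel : rel G := fun x y => `[< normal_set N (x^-1 * y)%g >].

Lemma coset_rel_refl : reflexive coset_rel.
Proof. by move=> x; apply/asboolP; rewrite mulVg. Qed.

Lemma coset_rel_sym : symmetric coset_rel.
Proof.
by move=> x y; apply/asboolP/asboolP=> /NV; rewrite invgM invgK.
Qed.

Lemma coset_rel_trans : transitive coset_rel.
Proof.
move=> y x z /asboolP xy /asboolP yz; apply/asboolP.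
by have := NM xy yz; rewrite mulgA mulgK.
Qed.

Canonical coset_equiv := EquivRel coset_rel coset_rel_refl coset_rel_sym coset_rel_trans.

Definition quot_group : Type := {eq_quot coset_equiv}.

HB.instance Definition _ := Choice.on quot_group.
HB.instance Definition _ := EqQuotient.on quot_group.

Lemma quot_piP x y : \pi_quot_group x = \pi_quot_group y <-> normal_set N (x^-1 * y)%g.
Proof. by split=> [/eqquotP/asboolP//|xy]; apply/eqquotP/asboolP. Qed.

Definition quot_mul (x y : quot_group) : quot_group := \pi_quot_group (repr x * repr y)%g.
Definition quot_one : quot_group := \pi_quot_group 1%g.
Definition quot_inv (x : quot_group) : quot_group := \pi_quot_group (repr x)^-1%g.

Lemma quot_repr x : normal_set N (x^-1 * repr (\pi_quot_group x))%g.
Proof. by apply/quot_piP; rewrite reprK. Qed.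

Lemma quot_piM x y : quot_mul (\pi x) (\pi y) = \pi_quot_group (x * y)%g.
Proof.
apply/esym/quot_piP; rewrite invgM -mulgA.
have := NM (normal_conj y (quot_repr x)) (quot_repr y).
by rewrite /conjg !mulgA mulgK.
Qed.

Lemma quot_piV x : quot_inv (\pi x) = \pi_quot_group x^-1%g.
Proof.
apply/quot_piP; rewrite invgK.
by have := normal_conj x^-1%g (quot_repr x); rewrite /conjg invgK mulgA mulVKg.
Qed.

Let mulA : associative quot_mul.
Proof. by move=> x y z; rewrite -[x]reprK -[y]reprK -[z]reprK !quot_piM mulgA. Qed.

Let mul1q : left_id quot_one quot_mul.
Proof. by move=> x; rewrite -[x]reprK /quot_one quot_piM mul1g. Qed.

Let mulq1 : right_id quot_one quot_mul.
Proof. by move=> x; rewrite -[x]reprK /quot_one quot_piM mulg1. Qed.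

Let mulVq : left_inverse quot_one quot_inv quot_mul.
Proof. by move=> x; rewrite -[x]reprK quot_piV quot_piM mulVg. Qed.

Let mulqV : right_inverse quot_one quot_inv quot_mul.
Proof. by move=> x; rewrite -[x]reprK quot_piV quot_piM mulgV. Qed.

HB.instance Definition _ := isGroup.Build quot_group mulA mul1q mulq1 mulVq mulqV.

End QuotientGroup.

Section LGroup.
Variables (p : nat) (X : Type).

Local Notation NX := (nil2 p (X + X)).

(* [inl v] and [inr v] index the free generators a_v and b_v. *)
Definition L_relators : set NX :=
  [set [~ nil2_gen p (inl v), nil2_gen p (inr v)]%g | v in [set: X]].

Lemma L_relators_normal x y :
  subgroup_gen L_relators x -> subgroup_gen L_relators (x ^ y)%g.
Proof.
have [_ N3] := nil2_variety p (X + X).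
pose C : set NX := [set z | commute z y].
have sub : subgroup_gen L_relators `<=` C.
  apply: smallest_sub; last first.
    move=> _ [v _ <-]; rewrite /C /= /commute.
    by rewrite conjgC -[X in (_ * X)%g](mulVKg [~ nil2_gen p (inl v), nil2_gen p (inr v)])%g
      -commgEl N3 mulg1.
  split=> [|u v Cu Cv]; rewrite /C /=; first exact/commute_sym/commute1.
  apply/commute_sym/commuteM; first exact/commute_sym.
  exact/commuteV/commute_sym.
move=> Lx; have /= cxy := sub _ Lx.
by rewrite conjgE [X in (_ * X)%g]cxy mulKg.
Qed.

Lemma subgroup_gen_is_subgroup (G : groupType) (S : set G) :
  is_subgroup (subgroup_gen S).
Proof.
split=> [|x y Sx Sy] H CH; first exact: CH.1.1.
exact: CH.1.2 (Sx H CH) (Sy H CH).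
Qed.

Definition L_subgroup : normal_subgroup NX :=
  NormalSubgroup (subgroup_gen_is_subgroup L_relators) L_relators_normal.

Definition L : Type := quot_group L_subgroup.

HB.instance Definition _ := Group.on L.
HB.instance Definition _ := EqQuotient.on L.

Definition L_gen (i : X + X) : L := \pi_L (nil2_gen p i).

Lemma L_piM (x y : NX) : \pi_L (x * y)%g = (\pi_L x * \pi_L y)%g.
Proof. exact/esym/quot_piM. Qed.

Lemma L_piV (x : NX) : \pi_L x^-1%g = (\pi_L x)^-1%g.
Proof. exact/esym/quot_piV. Qed.

Lemma L_piR (x y : NX) : \pi_L [~ x, y]%g = [~ \pi_L x, \pi_L y]%g.
Proof. by rewrite /commg /conjg !(L_piM, L_piV). Qed.

Lemma L_variety : in_nil2_variety p L.
Proof.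
have [N1 N2] := nil2_variety p (X + X).
have piX n (u : NX) : \pi_L (u ^+ n)%g = (\pi_L u ^+ n)%g.
  by elim: n => [|n IH]; [exact: erefl | rewrite !expgS L_piM IH].
split=> [x|x y z]; first by rewrite -[x]reprK -piX N1.
by rewrite -[x]reprK -[y]reprK -[z]reprK -(L_piR (repr x)) -(L_piR [~ _, _]%g) N2.
Qed.

Lemma L_gen_comm v : [~ L_gen (inl v), L_gen (inr v)]%g = 1%g.
Proof.
rewrite /L_gen -L_piR -[RHS]/(\pi_L 1%g).
apply/esym/quot_piP; rewrite invg1 mul1g.
by apply: sub_gen_smallest; exists v.
Qed.

End LGroup.

Section LMap.
Variables (p : nat) (X Y : Type) (q : X -> Y).

Definition L_map_gen (i : X + X) : L p Y :=
  match i with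
  | inl v => L_gen p (inl (q v))
  | inr v => L_gen p (inr (q v))
  end.

(* The value does not depend on the representative chosen by [repr]. *)
Definition L_map (x : L p X) : L p Y := nil2_lift L_map_gen (repr x).

Let liftM := @nil2_liftM p _ _ L_map_gen (L_variety p Y).

Let lift1 : nil2_lift (p := p) L_map_gen 1%g = 1%g.
Proof. by apply: (@mulgI _ (nil2_lift (p := p) L_map_gen 1%g)); rewrite -liftM !mulg1. Qed.

Let liftV x : nil2_lift (p := p) L_map_gen x^-1%g = (nil2_lift L_map_gen x)^-1%g.
Proof.
by apply: (@mulgI _ (nil2_lift L_map_gen x)); rewrite -liftM !mulgV lift1.
Qed.

Lemma L_map_pi x : L_map (\pi_(L p X) x) = nil2_lift L_map_gen x.
Proof.
suff sub : subgroup_gen (@L_relators p X) `<=`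
    [set z | nil2_lift L_map_gen z = 1%g].
  have /sub /= := quot_repr (L_subgroup p X) x.
  by rewrite liftM liftV => /mulg1_eq; rewrite invgK.
apply: smallest_sub => [|_ [v _ <-] /=].
  by split=> [//|u v /= u1 v1]; rewrite liftM liftV u1 v1 mulgV.
rewrite /commg /conjg !(liftM, liftV) !(nil2_lift_gen L_map_gen (L_variety p Y)).
exact: L_gen_comm.
Qed.

Lemma L_map_L_gen i : L_map (L_gen p i) = L_map_gen i.
Proof. by rewrite L_map_pi (nil2_lift_gen _ (L_variety p Y)). Qed.

Lemma L_mapM : {morph L_map : x y / x * y >-> x * y}%g.
Proof. by move=> x y; rewrite -[x]reprK -[y]reprK -L_piM !L_map_pi liftM. Qed.

HB.instance Definition _ := isMultiplicative.Build (L p X) (L p Y) L_map L_mapM.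

End LMap.

HB.mixin Record isTopologicalGroup G & Group G & Topological G := {
  mulg_continuous : continuous (fun x : G * G => (x.1 * x.2)%g);
  invg_continuous : continuous (fun x : G => x^-1%g) }.

#[short(type="topologicalGroupType")]
HB.structure Definition TopologicalGroup :=
  { G of Group G & Topological G & isTopologicalGroup G }.

Definition topologically_isomorphic (G H : topologicalGroupType) : Prop :=
  exists (f : {multiplicative G -> H}) (g : H -> G),
    [/\ cancel f g, cancel g f, continuous f & continuous g].

Section InverseLimit.
Variables (G : nat -> groupType) (f : forall n, {multiplicative G n.+1 -> G n}).

Definition inv_lim_set : set (prod_topology (fun n => discrete_topology (G n))) :=
  [set x | forall n, f n (x n.+1) = x n].

Definition inv_lim : Type := set_type inv_lim_set.

HB.instance Definition _ := Topological.on inv_lim.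

Let f1 n : f n 1%g = 1%g.
Proof. by apply: (@mulgI _ (f n 1%g)); rewrite -gmulfM !mulg1. Qed.

Let fV n x : f n x^-1%g = (f n x)^-1%g.
Proof. by apply: (@mulgI _ (f n x)); rewrite -gmulfM !mulgV f1. Qed.

Definition inv_lim_coord (x : inv_lim) n : G n := val x n.

Lemma inv_limP (x : inv_lim) n : f n (inv_lim_coord x n.+1) = inv_lim_coord x n.
Proof. exact: (set_valP x). Qed.

Lemma inv_lim_inj (x y : inv_lim) : (forall n, inv_lim_coord x n = inv_lim_coord y n) -> x = y.
Proof. by move=> xy; apply/val_inj/functional_extensionality_dep. Qed.

Fact inv_lim_one_subproof : inv_lim_set (fun n => 1%g : G n).
Proof. by move=> n; exact: f1. Qed.
Definition inv_lim_one : inv_lim := exist (fun z => z \in inv_lim_set) _ (mem_set inv_lim_one_subproof).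

Fact inv_lim_mul_subproof (x y : inv_lim) :
  inv_lim_set (fun n => inv_lim_coord x n * inv_lim_coord y n)%g.
Proof. by move=> n; rewrite gmulfM !inv_limP. Qed.
Definition inv_lim_mul (x y : inv_lim) : inv_lim :=
  exist (fun z => z \in inv_lim_set) _ (mem_set (inv_lim_mul_subproof x y)).

Fact inv_lim_inv_subproof (x : inv_lim) :
  inv_lim_set (fun n => (inv_lim_coord x n)^-1)%g.
Proof. by move=> n; rewrite fV inv_limP. Qed.
Definition inv_lim_inv (x : inv_lim) : inv_lim :=
  exist (fun z => z \in inv_lim_set) _ (mem_set (inv_lim_inv_subproof x)).

Let mulA : associative inv_lim_mul.
Proof. by move=> x y z; apply: inv_lim_inj => n; exact: mulgA. Qed.
Let mul1l : left_id inv_lim_one inv_lim_mul.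
Proof. by move=> x; apply: inv_lim_inj => n; exact: mul1g. Qed.
Let mull1 : right_id inv_lim_one inv_lim_mul.
Proof. by move=> x; apply: inv_lim_inj => n; exact: mulg1. Qed.
Let mulVl : left_inverse inv_lim_one inv_lim_inv inv_lim_mul.
Proof. by move=> x; apply: inv_lim_inj => n; exact: mulVg. Qed.
Let mullV : right_inverse inv_lim_one inv_lim_inv inv_lim_mul.
Proof. by move=> x; apply: inv_lim_inj => n; exact: mulgV. Qed.

HB.instance Definition _ := isGroup.Build inv_lim mulA mul1l mull1 mulVl mullV.

Lemma inv_lim_coord_near (x : inv_lim) n :
  \forall y \near x, inv_lim_coord y n = inv_lim_coord x n.
Proof.
have nx := discrete_set1 (inv_lim_coord x n : discrete_topology (G n)).
have /= nv := @proj_continuous nat (fun n => discrete_topology (G n)) n (val x) _ nx.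
exact: (@initial_continuous _ _ (@set_val _ inv_lim_set) x _ nv).
Qed.

Lemma inv_lim_cvg (X : topologicalType) (h : X -> inv_lim) (x0 : X) :
  (forall n, \forall x \near x0, inv_lim_coord (h x) n = inv_lim_coord (h x0) n) ->
  h x @[x --> x0] --> h x0.
Proof.
move=> hP U [_ [[W oW <-] Wh sU]]; apply: filterS sU _.
have : val (h x) @[x --> x0] --> val (h x0).
  apply/cvg_sup => i A [_ [[B oB <-] Bx sB]]; apply: filterS sB _.
  by apply: filterS (hP i) => x /= E; move: Bx; rewrite /= -[val _ i]E.
apply; exact: open_nbhs_nbhs.
Qed.

Let mul_cont : continuous (fun x : inv_lim * inv_lim => (x.1 * x.2)%g).
Proof.
move=> [x y]; apply: inv_lim_cvg => n.
exists ([set z | inv_lim_coord z n = inv_lim_coord x n],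
        [set z | inv_lim_coord z n = inv_lim_coord y n]) => /=.
  by split; exact: inv_lim_coord_near.
move=> [x' y'] [/= ex ey].
by rewrite -[LHS]/(inv_lim_coord x' n * inv_lim_coord y' n)%g ex ey.
Qed.

Let inv_cont : continuous (fun x : inv_lim => x^-1%g).
Proof.
move=> x; apply: inv_lim_cvg => n; apply: filterS (inv_lim_coord_near x n) => y e.
by rewrite -[LHS]/(inv_lim_coord y n)^-1%g e.
Qed.

HB.instance Definition _ := isTopologicalGroup.Build inv_lim mul_cont inv_cont.

End InverseLimit.

Record tree := Tree {
  tree_set : set (seq nat);
  tree_nonempty : tree_set !=set0;
  tree_prefix : forall s t, prefix s t -> tree_set t -> tree_set s }.

Definition pruned (T : tree) : Prop :=
  forall s, tree_set T s -> exists t, [/\ tree_set T t, prefix s t & t != s].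

Definition level (T : tree) (n : nat) : set (seq nat) :=
  [set s | tree_set T s /\ size s = n].

Fact level_pred_subproof (T : tree) (n : nat) (s : level T n.+1) :
  level T n (take n (val s)).
Proof.
have [Ts sz] := set_valP s; split; last by rewrite size_takel // sz.
by apply: tree_prefix Ts; exact: prefix_take.
Qed.

Definition level_pred (T : tree) (n : nat) (s : level T n.+1) : level T n :=
  exist (fun t => t \in level T n) _ (mem_set (level_pred_subproof s)).

Definition G_tree (p : nat) (T : tree) : Type :=
  @inv_lim (fun n => L p (level T n.+1))
           (fun n => @L_map p _ _ (@level_pred T n.+1)).

HB.instance Definition _ p T := TopologicalGroup.on (G_tree p T).

Definition branches (T : tree) : set (nat -> nat) :=
  [set x | forall n, tree_set T (mkseq x n)].

(* The distance is valued in [R], so the space carries [R] as a parameter. *)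
Definition branch_space (R : realType) (T : tree) : Type := set_type (branches T).

HB.instance Definition _ R T := Choice.on (branch_space R T).

Section BranchMetric.
Local Open Scope ring_scope.
Variables (R : realType) (T : tree).
Implicit Types x y z : branch_space R T.

Definition branch_dist x y : R :=
  if pselect (exists n, val x n != val y n) is left xy
  then 2 ^- ex_minn xy else 0.

Let dist_small x y n : (forall i, (i < n)%N -> val x i = val y i) -> branch_dist x y <= 2 ^- n.
Proof.
rewrite /branch_dist; case: pselect => [xy h|_ _]; last by rewrite invr_ge0 exprn_ge0.
case: ex_minnP => m xym _; rewrite lef_pV2 ?posrE ?exprn_gt0 //.
rewrite ler_weXn2l ?ler1n // leqNgt; apply/negP => /h/eqP.
by rewrite (negbTE xym).
Qed.

Let distxx x : branch_dist x x = 0.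
Proof. by rewrite /branch_dist; case: pselect => // xx; exfalso; case: xx => n; rewrite eqxx. Qed.

Let dist_ge0 x y : 0 <= branch_dist x y.
Proof. by rewrite /branch_dist; case: pselect => *; rewrite ?invr_ge0 ?exprn_ge0. Qed.

Let dist_pos x y : branch_dist x y = 0 -> x = y.
Proof.
rewrite /branch_dist; case: pselect => [xy /eqP|xy _].
  by rewrite invr_eq0 expf_eq0 pnatr_eq0 andbF.
apply/val_inj/funext => n; apply: contra_notP xy => /eqP xyn; by exists n.
Qed.

Let distP x y : x = y \/ exists n, [/\ branch_dist x y = 2 ^- n,
  val x n != val y n & forall i, (i < n)%N -> val x i = val y i].
Proof.
rewrite /branch_dist; case: pselect => [xy|xy].
  right; case: ex_minnP => n xyn nmin; exists n; split=> // i lt_in.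
  by apply/eqP; apply: contraLR lt_in; rewrite -leqNgt; exact: nmin.
left; apply/val_inj/funext => n; apply: contra_notP xy => /eqP xyn; by exists n.
Qed.

Let dist_sym x y : branch_dist x y = branch_dist y x.
Proof.
rewrite /branch_dist; case: pselect => xy; case: pselect => yx //.
- congr (2 ^- _); apply: eq_ex_minn => n; congr (~~ _); exact: eq_sym.
- by case: yx; case: xy => n; exists n; rewrite eq_sym.
- by case: xy; case: yx => n; exists n; rewrite eq_sym.
Qed.

Let dist_triangle y x z : branch_dist x z <= branch_dist x y + branch_dist y z.
Proof.
wlog le : x z / branch_dist x y <= branch_dist y z => [wl|].
  have [/wl//|/ltW] := leP (branch_dist x y) (branch_dist y z).
  by rewrite (dist_sym x z) addrC (dist_sym y z) (dist_sym x y) => /wl.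
apply: (@le_trans _ _ (branch_dist y z)); last by rewrite lerDr.
move: le.
have [yz|[n [-> _ yz]]] := distP y z; first by rewrite -yz.
have [xy|[m [-> _ xy]]] := distP x y; first by rewrite xy => _; exact: dist_small.
rewrite lef_pV2 ?posrE ?exprn_gt0 // ler_eXn2l ?ltr1n // => nm.
by apply: dist_small => i lt_in; rewrite xy ?yz // (leq_trans lt_in).
Qed.

HB.instance Definition _ := isMetric.Build R (branch_space R T)
  distxx dist_pos dist_sym dist_triangle.

End BranchMetric.

Definition uniformly_homeomorphic (X Y : uniformType) : Prop :=
  exists (f : X -> Y) (g : Y -> X),
    [/\ cancel f g, cancel g f, unif_continuous f & unif_continuous g].

(* Main.v *)
(* Sending all generators but two to 1 defines homomorphisms from L(X) to the
   Heisenberg group over F_p, which exist as p is odd. They show that the center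
   of L(X) is the kernel of the coordinate map to F_p^(X + X), and that two
   commuting elements, independent modulo the center, span modulo the center the
   plane <a_v, b_v> of a single v in X. Passing to the limit, the branches x of T
   correspond to the maximal commuting planes <a_x, b_x> of G_T modulo its
   center, so an isomorphism G_T -> G_U induces a bijection of branches; it is
   uniformly continuous because x agrees with y up to level n exactly when a_x
   and a_y have the same image in L(T_n).

   Conversely, a uniformly continuous map [T] -> [U] induces maps T_k -> U_n as
   soon as k is a modulus of continuity for n, hence a continuous homomorphism
   G_T -> G_U, functorially. *)
Require Import Defs.
From HB Require Import structures.
From mathcomp Require Import all_boot all_order all_algebra.
From mathcomp Require Import generic_quotient monoid ring.
From mathcomp Require Import all_classical all_reals topology.

Set Implicit Arguments.
Unset Strict Implicit.
Unset Printing Implicit Defensive.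

Import Order.TTheory GRing.Theory Num.Theory.

(** * Central elements and homomorphisms *)

Section Central.
Local Open Scope group_scope.

Definition central (G : groupType) (z : G) := forall g, commute z g.

Variable G : groupType.
Implicit Types x y z : G.

Lemma central1 : central (1 : G).
Proof. by move=> g; exact/commute_sym/commute1. Qed.

Lemma centralM x y : central x -> central y -> central (x * y).
Proof. by move=> cx cy g; apply/commute_sym/commuteM; exact/commute_sym. Qed.

Lemma multiplicative1 (H : groupType) (f : {multiplicative G -> H}) : f 1 = 1.
Proof. by apply: (@mulgI _ (f 1)); rewrite -gmulfM !mulg1. Qed.

Lemma multiplicativeV (H : groupType) (f : {multiplicative G -> H}) x :
  f x^-1 = (f x)^-1.
Proof. by apply: (@mulgI _ (f x)); rewrite -gmulfM !mulgV multiplicative1. Qed.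

Lemma multiplicativeX (H : groupType) (f : {multiplicative G -> H}) n x :
  f (x ^+ n) = f x ^+ n.
Proof.
by elim: n => [|n IH]; rewrite ?expg0 ?multiplicative1 // !expgS gmulfM IH.
Qed.

Lemma central_morph (H : groupType) (f : {multiplicative G -> H}) (g : H -> G) x :
  cancel g f -> central x -> central (f x).
Proof. by move=> gK cx y; rewrite -[y]gK /commute -!gmulfM cx. Qed.

End Central.

(** * The Heisenberg group over a commutative ring *)

Section Heisenberg.
Local Open Scope ring_scope.
Variable F : comNzRingType.

(* The matrix [[1, x, z], [0, 1, y], [0, 0, 1]] is encoded as ((x, y), z). *)
Definition heis : Type := (F * F * F)%type.

HB.instance Definition _ := Choice.on heis.

Definition heis_mul (g h : heis) : heis :=
  ((g.1.1 + h.1.1, g.1.2 + h.1.2), g.2 + h.2 + g.1.1 * h.1.2).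
Definition heis_one : heis := ((0, 0), 0).
Definition heis_inv (g : heis) : heis :=
  ((- g.1.1, - g.1.2), - g.2 + g.1.1 * g.1.2).

Lemma heis_eq (g h : heis) :
  g.1.1 = h.1.1 -> g.1.2 = h.1.2 -> g.2 = h.2 -> g = h.
Proof. by case: g h => [[x y] z] [[x' y'] z'] /= -> -> ->. Qed.

Let mulA : associative heis_mul.
Proof. by move=> g h k; apply: heis_eq => /=; ring. Qed.
Let mul1 : left_id heis_one heis_mul.
Proof. by move=> g; apply: heis_eq => /=; ring. Qed.
Let mulr1 : right_id heis_one heis_mul.
Proof. by move=> g; apply: heis_eq => /=; ring. Qed.
Let mulV : left_inverse heis_one heis_inv heis_mul.
Proof. by move=> g; apply: heis_eq => /=; ring. Qed.
Let mulrV : right_inverse heis_one heis_inv heis_mul.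
Proof. by move=> g; apply: heis_eq => /=; ring. Qed.

HB.instance Definition _ := isGroup.Build heis mulA mul1 mulr1 mulV mulrV.

Lemma heis_commute (g h : heis) :
  commute g h <-> g.1.1 * h.1.2 = h.1.1 * g.1.2.
Proof.
split=> [|e]; last by apply: heis_eq => /=; ring: e.
move/(congr1 (fun k : heis => k.2)) => /=.
by rewrite [h.2 + _]addrC => /addrI.
Qed.

(** Besides [g.2], the corner entry gains [k] copies of [g.1.1 * g.1.2] from the power [k] to the
    next, whence the binomial coefficient. *)
Lemma heisX (g : heis) n :
  (g ^+ n)%g = ((g.1.1 *+ n, g.1.2 *+ n),
                g.2 *+ n + (g.1.1 * g.1.2) *+ 'C(n, 2)) :> heis.
Proof.
elim: n => [|n IH]; first by rewrite addr0.
rewrite expgS IH binS bin1; apply: heis_eq => /=; rewrite ?mulrS //.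
rewrite mulrnDr mulrnAr; ring.
Qed.

Lemma heis_variety p : p \in [pchar F] -> odd p -> in_nil2_variety p heis.
Proof.
move=> charp oddp; split=> [g|g h k].
  rewrite heisX !(mulrn_pchar charp) add0r.
  (* Oddness enters here: a prime [p] divides ['C(p, 2)] only if [2 < p]. *)
  suff /dvdnP[m ->] : (p %| 'C(p, 2))%N by rewrite mulnC mulrnA (mulrn_pchar charp) mul0rn.
  apply: prime_dvd_bin; first exact: pcharf_prime charp.
  by rewrite /= ltn_neqAle prime_gt1 ?(pcharf_prime charp) // andbT;
    apply: contraTneq oddp => <-.
apply/eqP/commgP/heis_commute => /=; ring.
Qed.

End Heisenberg.

(** * The universal property of L(X) *)

Section LTheory.
Local Open Scope quotient_scope.
Local Open Scope group_scope.
Variables (p : nat) (X : Type).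

(** [L p X] is a quotient of a quotient of terms, so choosing representatives twice leaves an
    induction on terms. *)
Lemma L_ind (P : L p X -> Prop) :
    P 1 -> (forall i, P (L_gen p i)) ->
    (forall x y, P x -> P y -> P (x * y)) -> (forall x, P x -> P x^-1) ->
  forall x, P x.
Proof.
move=> P1 Pg PM PV x; rewrite -[x]reprK -[repr x]reprK.
elim: (repr (repr x)) => [i||s IHs t IHt|s IHs].
- exact: Pg.
- exact: P1.
- have -> : \pi_(nil2 p (X + X)) (GMul s t) =
    \pi_(nil2 p (X + X)) s * \pi_(nil2 p (X + X)) t by exact/esym/nil2_piM.
  by rewrite L_piM; exact: PM.
- have -> : \pi_(nil2 p (X + X)) (GInv s) = (\pi_(nil2 p (X + X)) s)^-1
    by exact/esym/nil2_piV.
  by rewrite L_piV; exact: PV.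
Qed.

Lemma L_commR_central (x y : L p X) : central [~ x, y].
Proof. by move=> z; apply/commgP/eqP; exact: (L_variety p X).2. Qed.

Lemma L_central_gen (x : L p X) :
  (forall i, commute x (L_gen p i)) -> central x.
Proof.
move=> cx; apply: L_ind => [|i|y z|y]; [exact: commute1|exact: cx|exact: commuteM|exact: commuteV].
Qed.

Section Lift.
Variables (G : groupType) (f : X + X -> G).
Hypothesis GP : in_nil2_variety p G.
Hypothesis f_comm : forall v, commute (f (inl v)) (f (inr v)).

Definition L_lift (x : L p X) : G := nil2_lift f (repr x).

Let liftM := @nil2_liftM p _ _ f GP.

Let lift1 : nil2_lift (p := p) f 1 = 1.
Proof. by apply: (@mulgI _ (nil2_lift (p := p) f 1)); rewrite -liftM !mulg1. Qed.

Let liftV x : nil2_lift (p := p) f x^-1 = (nil2_lift f x)^-1.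
Proof. by apply: (@mulgI _ (nil2_lift f x)); rewrite -liftM !mulgV lift1. Qed.

Lemma L_lift_pi x : L_lift (\pi_(L p X) x) = nil2_lift f x.
Proof.
(* The kernel of the lift is a subgroup containing the relators, so the value does not depend on the
   representative. *)
suff sub : (subgroup_gen (@L_relators p X) `<=`
    [set z | nil2_lift f z = 1%g])%classic.
  have /sub /= := quot_repr (L_subgroup p X) x.
  by rewrite liftM liftV => /mulg1_eq; rewrite invgK.
apply: smallest_sub => [|_ [v _ <-] /=].
  by split=> [//|u v /= u1 v1]; rewrite liftM liftV u1 v1 mulgV.
rewrite /commg /conjg !(liftM, liftV) !(nil2_lift_gen f GP).
exact/eqP/commgP/f_comm.
Qed.

Lemma L_lift_gen i : L_lift (L_gen p i) = f i.
Proof. by rewrite L_lift_pi (nil2_lift_gen _ GP). Qed.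

Lemma L_liftM : {morph L_lift : x y / x * y}.
Proof. by move=> x y; rewrite -[x]reprK -[y]reprK -L_piM !L_lift_pi liftM. Qed.

Lemma L_lift1 : L_lift 1 = 1.
Proof. by rewrite -[1]/(\pi_(L p X) 1) L_lift_pi lift1. Qed.

Lemma L_liftV : {morph L_lift : x / x^-1}.
Proof. by move=> x; rewrite -[x]reprK -L_piV !L_lift_pi liftV. Qed.

End Lift.

Lemma L_morph_eq (G : groupType) (f g : {multiplicative L p X -> G}) :
  (forall i, f (L_gen p i) = g (L_gen p i)) -> f =1 g.
Proof.
move=> fg; apply: L_ind => [|//|x y|x]; first by rewrite !multiplicative1.
  by rewrite !gmulfM => -> ->.
by rewrite !multiplicativeV => ->.
Qed.

End LTheory.

(** * Coordinates of L(X) modulo its center *)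

Section LCoord.
Local Open Scope ring_scope.
Variables (p : nat) (p_prime : prime p) (p_odd : odd p) (X : Type).
Implicit Types (i j k : X + X) (x y z : L p X) (v w : X).

(** The other generator over the same point, with which [i] commutes in L(X). *)
Definition partner i : X + X :=
  match i with inl v => inr v | inr v => inl v end.

Lemma partnerK : involutive partner. Proof. by case. Qed.

Lemma partner_neq i : i <> partner i. Proof. by case: i. Qed.

(** For [i <> j] these two generators go to the two superdiagonal elementary matrices and all others
    to 1; for [i = j] that generator gets both entries. *)
Definition heis_test i j k : heis 'F_p :=
  ((`[< k = i >]%:R, `[< k = j >]%:R), 0).

(** Both products in the commutation criterion vanish: a nonzero one would make [i] and [j] the two
    generators over [v]. *)
Lemma heis_test_commute i j : j <> partner i ->
  forall v, commute (heis_test i j (inl v)) (heis_test i j (inr v)).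
Proof.
move=> ji v; apply/heis_commute => /=.
rewrite -!natrM !mulnb -!asbool_and; congr (_%:R); congr nat_of_bool.
by apply: asbool_equiv_eq; split=> -[e1 e2]; case: ji; rewrite -e1 -e2.
Qed.

(** The exponent sum of generator [i] modulo [p]; the choice [j = i] is always admissible, as no
    generator is its own partner. *)
Definition L_coord i x : 'F_p := (L_lift (heis_test i i) x).1.1.

Let heisP : in_nil2_variety p (heis 'F_p) := heis_variety (pchar_Fp p_prime) p_odd.
Let testP i := heis_test_commute (@partner_neq i).

Lemma L_coord1 i : L_coord i 1%g = 0.
Proof. by rewrite /L_coord (L_lift1 heisP (testP i)). Qed.

Lemma L_coordM i x y : L_coord i (x * y)%g = L_coord i x + L_coord i y.
Proof. by rewrite /L_coord (L_liftM heisP (testP i)). Qed.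

Lemma L_coordV i x : L_coord i x^-1%g = - L_coord i x.
Proof. by rewrite /L_coord (L_liftV heisP (testP i)). Qed.

Lemma L_coordX i x n : L_coord i (x ^+ n)%g = L_coord i x *+ n.
Proof.
by elim: n => [|n IH]; rewrite ?expg0 ?L_coord1 // expgS L_coordM IH mulrS.
Qed.

Lemma L_coord_gen i k : L_coord i (L_gen p k) = `[< k = i >]%:R.
Proof. by rewrite /L_coord (L_lift_gen heisP (testP i)). Qed.

Lemma L_lift_test i j x : j <> partner i ->
  (L_lift (heis_test i j) x).1 = (L_coord i x, L_coord j x).
Proof.
move=> ji; have tP := heis_test_commute ji.
elim/L_ind: x => [|k|x y IHx IHy|x IHx].
- by rewrite (L_lift1 heisP tP) !L_coord1.
- by rewrite (L_lift_gen heisP tP) !L_coord_gen.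
- by rewrite (L_liftM heisP tP) !L_coordM /= IHx IHy.
- by rewrite (L_liftV heisP tP) !L_coordV /= IHx.
Qed.

(** The images in the Heisenberg group commute, and there commuting means that a 2x2 minor
    vanishes. *)
Lemma commute_L_coord i j x y : commute x y -> j <> partner i ->
  L_coord i x * L_coord j y = L_coord i y * L_coord j x.
Proof.
move=> cxy ji; have := L_liftM heisP (heis_test_commute ji).
move=> liftM; have : commute (L_lift (heis_test i j) x) (L_lift (heis_test i j) y).
  by rewrite /commute -!liftM cxy.
by move/heis_commute; rewrite !L_lift_test.
Qed.

Lemma central_L_coord : (forall v, exists w, w <> v) ->
  forall x, central x -> forall i, L_coord i x = 0.
Proof.
move=> X2 x cx i.
(* A generator over a second point; commuting with it isolates the coordinate [i]. *)
have [j [ji jpi]] : exists j, j <> i /\ j <> partner i.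
  by case: i => v; have [w wv] := X2 v; [exists (inl w)|exists (inr w)]; split=> // -[].
have := commute_L_coord (cx (L_gen p j)) jpi.
by rewrite !L_coord_gen asboolT // asboolF // mulr1 mul0r.
Qed.

Lemma natr_Fp_eq0 n : n%:R = 0 :> 'F_p -> (p %| n)%N.
Proof. by move/eqP; rewrite -(dvdn_pcharf (pchar_Fp p_prime)). Qed.

Lemma Fp_natP (a : 'F_p) : exists2 n : nat, (n < p)%N & n%:R = a.
Proof.
by exists a; [rewrite -[X in (_ < X)%N]Fp_cast // ltn_ord | rewrite natr_Zp].
Qed.

Lemma L_expg_eq x (a b : nat) : a%:R = b%:R :> 'F_p -> (x ^+ a = x ^+ b)%g.
Proof.
move/(congr1 (@nat_of_ord _)); rewrite !val_Fp_nat // => ab.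
have modE n : (x ^+ n = x ^+ (n %% p))%g.
  by rewrite {1}(divn_eq n p) expgnDr mulnC expgnA (L_variety p X).1 expg1n mul1g.
by rewrite modE ab -modE.
Qed.

Lemma L_expg_dvd x n : (p %| n)%N -> (x ^+ n = 1)%g.
Proof. by case/dvdnP=> m ->; rewrite mulnC expgnA (L_variety p X).1 expg1n. Qed.

(** Modulo the center L(X) is abelian of exponent [p], so ordered products with natural exponents
    exhaust the subgroup generated by [s] and the center. *)
Fixpoint L_span (s : seq (X + X)) x : Prop :=
  match s with
  | [::] => central x
  | i :: s' => exists n y, L_span s' y /\ x = (L_gen p i ^+ n * y)%g
  end.

Lemma L_span_centralM s x z : L_span s x -> central z -> L_span s (x * z)%g.
Proof.
elim: s x => [|i s IH] x /=; first exact: centralM.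
by case=> n [y [sy ->]] cz; exists n, (y * z)%g; rewrite mulgA; split=> //; exact: IH.
Qed.

Lemma L_spanM s x y : L_span s x -> L_span s y -> L_span s (x * y)%g.
Proof.
elim: s x y => [|i s IH] x y /=; first exact: centralM.
move=> [n [x' [sx ->]]] [m [y' [sy ->]]].
(* Swapping [x'] with the power of generator [i] costs a central commutator, which goes into the
   tail. *)
have cR := L_commR_central x' (L_gen p i ^+ m)%g.
have := commgC x' (L_gen p i ^+ m)%g; move: [~ _, _]%g cR => r cr xr.
exists (n + m)%N, (x' * y' * r)%g; split; first by apply: L_span_centralM => //; exact: IH.
by rewrite expgnDr -(mulgA x') -(cr y') -!mulgA; congr (_ * _)%g; rewrite !mulgA xr.
Qed.

Lemma L_span_central s z : central z -> L_span s z.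
Proof.
by move=> cz; elim: s => [|i s IH] //=; exists 0, z; rewrite expg0 mul1g.
Qed.

Lemma L_spanX s x n : L_span s x -> L_span s (x ^+ n)%g.
Proof.
move=> sx; elim: n => [|n IH]; first exact/L_span_central/central1.
by rewrite expgS; exact: L_spanM.
Qed.

Lemma L_spanV s x : L_span s x -> L_span s x^-1%g.
Proof.
move=> sx; rewrite (mulg1_eq (y := x ^+ p.-1)%g); first exact: L_spanX.
by rewrite -expgS prednK ?prime_gt0 // (L_variety p X).1.
Qed.

Lemma L_span_catl s t x : L_span s x -> L_span (s ++ t) x.
Proof.
elim: s x => [|i s IH] x /=; first exact: L_span_central.
by case=> n [y [sy ->]]; exists n, y; split=> //; exact: IH.
Qed.

Lemma L_span_catr s t x : L_span t x -> L_span (s ++ t) x.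
Proof. by move=> tx; elim: s => [|i s IH] //=; exists 0, x; rewrite expg0 mul1g. Qed.

Lemma L_span_gen s i : List.In i s -> L_span s (L_gen p i).
Proof.
elim: s => [//|j s IH] /= [->|/IH si].
  by exists 1%N, 1%g; rewrite mulg1; split=> //; exact/L_span_central/central1.
by exists 0, (L_gen p i); rewrite expg0 mul1g.
Qed.

Lemma L_spanP x : exists s, L_span s x.
Proof.
elim/L_ind: x => [|i|x y [s sx] [t ty]|x [s sx]].
- by exists [::]; exact: central1.
- by exists [:: i]; apply: L_span_gen; left.
- by exists (s ++ t); apply: L_spanM; [exact: L_span_catl|exact: L_span_catr].
- by exists s; exact: L_spanV.
Qed.

Lemma L_span_coord_notin s x i : (forall z, central z -> L_coord i z = 0) ->
  L_span s x -> ~ List.In i s -> L_coord i x = 0.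
Proof.
move=> ci; elim: s x => [|j s IH] x /=; first by move=> /ci.
case=> n [y [sy ->]] /not_orP[ji si].
by rewrite L_coordM L_coordX L_coord_gen asboolF // mul0rn add0r IH.
Qed.

(** Induction on a spanning list: a head that recurs in the tail is absorbed there; otherwise its
    exponent is a coordinate of [x], hence zero modulo [p], and its power is 1. *)
Lemma L_coord0_central : (forall v, exists w, w <> v) ->
  forall x, (forall i, L_coord i x = 0) -> central x.
Proof.
move=> X2 x; have [s] := L_spanP x; elim: s x => [//|i s IH] x /= [n [y [sy ->]]] x0.
have [si|si] := pselect (List.In i s).
  by apply: IH => //; apply: L_spanM => //; exact/L_spanX/L_span_gen.
have /natr_Fp_eq0 /L_expg_dvd n0 : n%:R = 0 :> 'F_p.
  rewrite -(x0 i) L_coordM L_coordX L_coord_gen asboolT //.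
  by rewrite (L_span_coord_notin _ sy si) ?addr0 // => z cz; exact: central_L_coord.
by move: x0; rewrite n0 mul1g; exact: IH.
Qed.

(** * The planes of a_v and b_v modulo the center *)

Definition L_plane_elt v (a b : nat) : L p X :=
  (L_gen p (inl v) ^+ a * L_gen p (inr v) ^+ b)%g.

Definition L_plane v x :=
  exists a b z, central z /\ x = (L_plane_elt v a b * z)%g.

Hypothesis X2 : forall v, exists w, w <> v.

Lemma L_coord_plane_inl v a b z : central z ->
  L_coord (inl v) (L_plane_elt v a b * z)%g = a%:R.
Proof.
move=> cz; rewrite !L_coordM !L_coordX !L_coord_gen (central_L_coord X2 cz).
by rewrite asboolT // asboolF // mul0rn !addr0.
Qed.

Lemma L_coord_plane_inr v a b z : central z ->
  L_coord (inr v) (L_plane_elt v a b * z)%g = b%:R.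
Proof.
move=> cz; rewrite !L_coordM !L_coordX !L_coord_gen (central_L_coord X2 cz).
by rewrite asboolF // asboolT // mul0rn add0r addr0.
Qed.

Lemma L_coord_plane_other v x i : L_plane v x -> i <> inl v -> i <> inr v ->
  L_coord i x = 0.
Proof.
move=> [a [b [z [cz ->]]]] ia ib.
rewrite !L_coordM !L_coordX !L_coord_gen (central_L_coord X2 cz).
by rewrite asboolF ?asboolF ?mul0rn ?addr0 // => e; [apply: ib|apply: ia].
Qed.

(** Dividing [x] by the plane element with the same coordinates over [v] makes all coordinates zero,
    so the quotient is central. *)
Lemma L_planeP v x : (forall i, i <> inl v -> i <> inr v -> L_coord i x = 0) ->
  L_plane v x.
Proof.
move=> x0; have [a _ ea] := Fp_natP (L_coord (inl v) x).
have [b _ eb] := Fp_natP (L_coord (inr v) x).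
exists a, b, ((L_plane_elt v a b)^-1 * x)%g; split; last by rewrite mulVKg.
apply: L_coord0_central => // i; rewrite L_coordM L_coordV.
rewrite -[L_plane_elt v a b]mulg1.
have [->|ia] := pselect (i = inl v).
  by rewrite L_coord_plane_inl ?ea ?addNr //; exact: central1.
have [->|ib] := pselect (i = inr v).
  by rewrite L_coord_plane_inr ?eb ?addNr //; exact: central1.
rewrite x0 // addr0 (L_coord_plane_other (v := v)) ?oppr0 //.
by exists a, b, 1%g; split=> //; exact: central1.
Qed.

(** For distinct points every coordinate of [x] would vanish: those over [v] by the plane of [w],
    the others by the plane of [v]. *)
Lemma L_plane_disjoint v w x : L_plane v x -> L_plane w x -> ~ central x -> v = w.
Proof.
move=> vx wx ncx; apply: contrapT => vw; apply: ncx; apply: L_coord0_central => // i.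
have [iv|iv] := pselect (i = inl v \/ i = inr v).
  by apply: (L_coord_plane_other wx); case: iv => -> // -[].
by apply: (L_coord_plane_other vx) => e; apply: iv; [left|right].
Qed.

Lemma L_plane_central v a b z : central z ->
  central (L_plane_elt v a b * z)%g -> (p %| a)%N /\ (p %| b)%N.
Proof.
move=> cz /(central_L_coord X2) c; split; apply: natr_Fp_eq0.
  by rewrite -(L_coord_plane_inl v a b cz).
by rewrite -(L_coord_plane_inr v a b cz).
Qed.

(* A nonzero 2x2 minor of the coordinates of a commuting pair can only occur in
   columns a_v, b_v; every other column is then parallel to both of these. *)
Lemma L_commute_plane x y : commute x y -> ~ central x ->
  (forall n, (n < p)%N -> ~ central (y * x ^+ n)%g) -> exists v, L_plane v x /\ L_plane v y.
Proof.
move=> cxy ncx ncy.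
have /existsNP[i xi] : ~ forall i, L_coord i x = 0 by move=> /(L_coord0_central X2).
(* This [n] cancels coordinate [i] of [y * x ^+ n]; a surviving coordinate [j] then gives a nonzero
   minor in columns [i] and [j]. *)
have [n np en] := Fp_natP (- L_coord i y / L_coord i x).
have /existsNP[j xj] : ~ forall j, L_coord j (y * x ^+ n)%g = 0.
  by move=> /(L_coord0_central X2); exact: ncy np.
have minor : L_coord i x * L_coord j y - L_coord i y * L_coord j x != 0.
  apply/eqP => m0; apply: xj; rewrite L_coordM L_coordX -[_ *+ n]mulr_natl en.
  apply: (mulfI (introN eqP xi)); rewrite mulr0 -m0; field; exact/eqP.
have {}ji : j = partner i.
  by apply: contrapT => /(commute_L_coord cxy) e; move: minor; rewrite e subrr eqxx.
have zero k : k <> i -> k <> j -> L_coord k x = 0 /\ L_coord k y = 0.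
  move=> ki kj.
  have e1 : L_coord i x * L_coord k y = L_coord i y * L_coord k x.
    by apply: commute_L_coord => //; rewrite -ji.
  have e2 : L_coord j x * L_coord k y = L_coord j y * L_coord k x.
    by apply: commute_L_coord => //; rewrite ji partnerK.
  (* Cramer's rule: [e1] and [e2] are a homogeneous system in the column [k] whose determinant is
     the minor, up to sign. *)
  split; apply: (mulfI minor); rewrite mulr0.
    rewrite mulrBl -mulrA -e2 [L_coord i y * _]mulrC -mulrA -e1; ring.
  rewrite mulrBl [L_coord i x * _]mulrC -mulrA e1 -mulrA e2; ring.
by move: ji zero {xi en minor}; case: i => v -> zero; exists v; split;
  apply: L_planeP => k k1 k2; apply zero.
Qed.

End LCoord.

(** * Functoriality of L in the index set *)

Section LMapTheory.
Local Open Scope group_scope.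
Variables (p : nat) (X Y : Type) (q : X -> Y).

Lemma L_map_id (x : L p X) : L_map id x = x.
Proof.
have := @L_morph_eq p X _ (L_map (p := p) (@id X)) idfun.
by apply=> -[v|v]; exact: L_map_L_gen.
Qed.

Lemma L_map_comp (Z : Type) (r : Y -> Z) (x : L p X) :
  L_map r (L_map q x) = L_map (r \o q) x.
Proof.
have := @L_morph_eq p X _ (L_map (p := p) r \o L_map (p := p) q) (L_map (p := p) (r \o q)).
apply=> i; change (L_map r (L_map q (L_gen p i)) = L_map (r \o q) (L_gen p i)).
by rewrite !L_map_L_gen; case: i => v; rewrite /L_map_gen L_map_L_gen.
Qed.

(** A surjection hits every generator, and commuting with the generators suffices for centrality. *)
Lemma L_map_central (x : L p X) : (forall v, exists w, q w = v) ->
  central x -> central (L_map q x).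
Proof.
move=> qs cx; apply: L_central_gen => -[v|v]; have [w <-] := qs v.
  by rewrite -[L_gen _ _](L_map_L_gen p q (inl w)) /commute -!gmulfM cx.
by rewrite -[L_gen _ _](L_map_L_gen p q (inr w)) /commute -!gmulfM cx.
Qed.

Lemma L_map_plane_elt v a b :
  L_map q (L_plane_elt p v a b) = L_plane_elt p (q v) a b.
Proof. by rewrite gmulfM !multiplicativeX /= !L_map_L_gen. Qed.

Lemma L_map_plane v (x : L p X) : (forall v, exists w, q w = v) ->
  L_plane v x -> L_plane (q v) (L_map q x).
Proof.
move=> qs [a [b [z [cz ->]]]]; exists a, b, (L_map q z).
by rewrite gmulfM /= L_map_plane_elt; split=> //; exact: L_map_central.
Qed.

End LMapTheory.

(** * Branches and levels of a tree *)

Section Branches.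
Local Open Scope classical_set_scope.
Variable T : tree.
Implicit Types x y : branches T.

Definition branch_level x n : level T n :=
  exist (fun s => s \in level T n) (mkseq (val x) n)
    (mem_set (conj (set_valP x n) (size_mkseq (val x) n))).

Lemma level_pred_branch x n : level_pred (branch_level x n.+1) = branch_level x n.
Proof.
apply: val_inj => /=; apply: (@eq_from_nth _ 0).
  by rewrite size_takel !size_mkseq.
move=> i; rewrite size_takel ?size_mkseq // => ltin.
by rewrite nth_take // !nth_mkseq // ltnW.
Qed.

Lemma branch_level_eq x y n :
  branch_level x n = branch_level y n <-> forall i, (i < n)%N -> val x i = val y i.
Proof.
split=> [/(congr1 val) /= xy i lti|xy].
  by rewrite -(nth_mkseq 0 (val x) lti) xy nth_mkseq.
by apply/val_inj/(@eq_from_nth _ 0); rewrite ?size_mkseq // => i lti; rewrite !nth_mkseq ?xy.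
Qed.

Lemma branch_level_le x y m n : (m <= n)%N ->
  branch_level x n = branch_level y n -> branch_level x m = branch_level y m.
Proof.
move=> le /branch_level_eq xy; apply/branch_level_eq => i lti.
by apply: xy; exact: leq_trans le.
Qed.

Lemma branch_inj x y : (forall n, branch_level x n.+1 = branch_level y n.+1) -> x = y.
Proof.
move=> xy; apply/val_inj/funext => n.
by have /branch_level_eq := xy n; apply.
Qed.

(** The shift by [N] serves families of nodes known only far up the tree; lower levels are recovered
    as prefixes. *)
Lemma branch_of_levels N (v : forall n, level T (n + N).+1) :
  (forall n, level_pred (v n.+1) = v n) ->
  exists x, forall n, branch_level x (n + N).+1 = v n.
Proof.
move=> vP; have szv n : size (val (v n)) = (n + N).+1 by have [] := set_valP (v n).
have nthS n i : (i <= n + N)%N -> nth 0 (val (v n.+1)) i = nth 0 (val (v n)) i.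
  by move=> le; rewrite -(vP n) /= nth_take.
have nthD n k i : (i <= n + N)%N -> nth 0 (val (v (k + n))) i = nth 0 (val (v n)) i.
  move=> le; elim: k => [//|k <-]; rewrite addSn nthS //.
  by rewrite (leq_trans le) // leq_add2r leq_addl.
(* [v i] has length [i + N + 1], so its entry [i] is never the default 0. *)
pose x i := nth 0 (val (v i)) i.
have xE n : mkseq x (n + N).+1 = val (v n).
  apply: (@eq_from_nth _ 0); first by rewrite size_mkseq szv.
  rewrite size_mkseq => i lti; rewrite nth_mkseq // /x.
  have [le|/ltnW le] := leqP i n.
    by have := nthD i (n - i)%N i; rewrite subnK // => ->; rewrite ?leq_addr.
  by have := nthD n (i - n)%N i; rewrite subnK // => ->.
have xT : x \in branches T.
  apply/mem_set => n; apply: (@tree_prefix T _ (mkseq x (n + N).+1)).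
    rewrite prefixE size_mkseq; apply/eqP/(@eq_from_nth _ 0).
      by rewrite size_takel !size_mkseq // leqW // leq_addr.
    rewrite size_takel ?size_mkseq ?leqW ?leq_addr // => i lti.
    by rewrite nth_take // !nth_mkseq // leqW // ltn_addr.
  by rewrite xE; have [] := set_valP (v n).
by exists (exist _ x xT) => n; apply: val_inj => /=; exact: xE.
Qed.

Hypothesis Tp : pruned T.

Lemma level_pred_surj n (v : level T n) : exists w : level T n.+1, level_pred w = v.
Proof.
have [Tv szv] := set_valP v; have [t [Tt /prefixP[s tE] ts]] := Tp Tv.
case: s tE ts => [|k s] tE ts; first by move: ts; rewrite tE cats0 eqxx.
have Tk : tree_set T (rcons (val v) k).
  apply: tree_prefix Tt; rewrite tE -cat_rcons; exact: prefix_prefix.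
have lk : rcons (val v) k \in level T n.+1.
  by apply/mem_set; split=> //; rewrite size_rcons szv.
exists (exist (fun s => s \in level T n.+1) _ lk); apply: val_inj => /=.
by rewrite -cats1 take_size_cat.
Qed.

Lemma branch_extend n (v : level T n.+1) : exists x, branch_level x n.+1 = v.
Proof.
pose c k (w : level T k) := projT1 (cid (level_pred_surj w)).
have cP k (w : level T k) : level_pred (c k w) = w := projT2 (cid (level_pred_surj w)).
pose w := fix w k : level T (k + n).+1 :=
  if k is k'.+1 then c _ (w k') else v.
have [x xw] := @branch_of_levels n w (fun k => cP _ (w k)).
by exists x; rewrite (xw 0).
Qed.

Hypothesis T1 : infinite_set (level T 1).

(** Every node of level 1 extends to a branch; were [v] alone in its level, all these branches would
    pass through [v] and level 1 would be a single node. *)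
Lemma level_two n (v : level T n.+1) : exists w, w <> v.
Proof.
apply: contrapT => all_v; apply: T1.
apply: (@sub_finite_set _ _ [set take 1 (val v)]); last exact: finite_set1.
move=> s Ts; have [x xs] := branch_extend (exist (fun s => s \in level T 1) s (mem_set Ts)).
have xv : branch_level x n.+1 = v by apply: contrapT => ne; apply: all_v; exists (branch_level x n.+1).
have := congr1 val xs => /= <-; have := congr1 val xv => /= <-.
by rewrite /mkseq /= take0.
Qed.

End Branches.

(** * Inverse limits of discrete groups *)

Section InvLimTheory.
Local Open Scope classical_set_scope.
Variables (G : nat -> groupType) (f : forall n, {multiplicative G n.+1 -> G n}).
Implicit Types x y : inv_lim f.

Lemma inv_lim_coord_le x y m n : (m <= n)%N ->
  inv_lim_coord x n = inv_lim_coord y n -> inv_lim_coord x m = inv_lim_coord y m.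
Proof.
move=> /subnK <-; elim: (n - m)%N => [//|k IH] e.
by apply: IH; rewrite -(inv_limP x) -(inv_limP y) [inv_lim_coord x _]e.
Qed.

(** A coordinate determines all earlier ones, so finitely many conditions on coordinates reduce to
    one at the largest index. *)
Lemma inv_lim_nbhs x (A : set (inv_lim f)) : nbhs x A ->
  exists n, forall y, inv_lim_coord y n = inv_lim_coord x n -> A y.
Proof.
(* The sets containing a cylinder around [x] form a filter; the claim is that it converges to
   [x]. *)
pose F : set_system (inv_lim f) :=
  [set B | exists n, forall y, inv_lim_coord y n = inv_lim_coord x n -> B y].
have FF : Filter F.
  split; first by exists 0.
    move=> B C [n Bn] [m Cm]; exists (maxn n m) => y e; split.
      by apply: Bn; exact: inv_lim_coord_le (leq_maxl n m) e.
    by apply: Cm; exact: inv_lim_coord_le (leq_maxr n m) e.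
  by move=> B C BC [n Bn]; exists n => y /Bn/BC.
suff : F --> x by exact.
move=> U [_ [[W oW <-] Wx sU]]; apply: filterS sU _.
have : val @ F --> val x.
  apply/cvg_sup => i B [_ [[C oC <-] Cx sB]]; apply: filterS sB _.
  by exists i => y e; move: Cx; rewrite /= -[val _ i]e.
by apply; exact: open_nbhs_nbhs.
Qed.

Lemma inv_lim_exists (x : forall n, G n) : (forall n, f n (x n.+1) = x n) ->
  exists y : inv_lim f, forall n, inv_lim_coord y n = x n.
Proof.
by move=> xP; exists (exist (fun z => z \in inv_lim_set f) x (mem_set xP)).
Qed.

Lemma inv_lim_coordM x y n :
  inv_lim_coord (x * y)%g n = (inv_lim_coord x n * inv_lim_coord y n)%g.
Proof. by []. Qed.

Lemma inv_lim_coordV x n : inv_lim_coord x^-1%g n = (inv_lim_coord x n)^-1%g.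
Proof. by []. Qed.

Lemma inv_lim_coordX x k n : inv_lim_coord (x ^+ k)%g n = (inv_lim_coord x n ^+ k)%g.
Proof. by elim: k => [//|k IH]; rewrite !expgS inv_lim_coordM IH. Qed.

Lemma inv_lim_commute x y : commute x y <->
  forall n, commute (inv_lim_coord x n) (inv_lim_coord y n).
Proof.
split=> [xy n|xy]; first by rewrite /commute -!inv_lim_coordM xy.
by apply: inv_lim_inj => n; exact: xy.
Qed.

End InvLimTheory.

(** A modulus at the identity serves everywhere, by translation: it is applied to [x / y]. *)
Lemma inv_lim_continuous_coord (G H : nat -> groupType)
    (f : forall n, {multiplicative G n.+1 -> G n})
    (g : forall n, {multiplicative H n.+1 -> H n})
    (h : {multiplicative inv_lim f -> inv_lim g}) : continuous h ->
  forall n, exists m, forall x y, inv_lim_coord x m = inv_lim_coord y m ->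
    inv_lim_coord (h x) n = inv_lim_coord (h y) n.
Proof.
move=> hc n; have := hc 1%g _ (inv_lim_coord_near (h 1%g) n).
move=> /inv_lim_nbhs[m hm]; exists m => x y xy.
have := hm (x / y)%g; rewrite multiplicative1 => hxy.
apply: divg1_eq.
rewrite -inv_lim_coordV -inv_lim_coordM -multiplicativeV -gmulfM.
by apply: hxy; rewrite inv_lim_coordM inv_lim_coordV xy mulgV.
Qed.

(** * Uniform continuity in terms of levels *)

Section BranchUniform.
Local Open Scope ring_scope.
Variable R : realType.

(** The strict bound puts any first difference beyond index [n], so the entries 0 to [n] agree,
    which is level [n.+1]. *)
Lemma branch_dist_lt (T : tree) (x y : branch_space R T) n :
  branch_dist x y < 2 ^- n <->
  branch_level (x : branches T) n.+1 = branch_level (y : branches T) n.+1.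
Proof.
rewrite /branch_dist; case: pselect => [xy|xy].
  case: ex_minnP => m xym mmin.
  rewrite ltf_pV2 ?posrE ?exprn_gt0 // ltr_eXn2l ?ltr1n //.
  split=> [nm|/branch_level_eq e].
    apply/branch_level_eq => i; rewrite ltnS => le; apply/eqP/negPn/negP => /mmin.
    by rewrite leqNgt (leq_ltn_trans le nm).
  by rewrite ltnNge; apply/negP => /e/eqP; rewrite (negbTE xym).
rewrite invr_gt0 exprn_gt0 //; split=> // _.
by apply/branch_level_eq => i _; apply/eqP/negPn/negP => ne; apply: xy; exists i.
Qed.

Lemma exists_pow2_lt (e : R) : 0 < e -> exists n, 2 ^- n < e.
Proof.
move=> e0; have := @archi_boundP _ e^-1 (ltW _); rewrite invr_gt0 => /(_ e0).
set n := Num.bound _ => ne; exists n; rewrite -[e]invrK ltf_pV2 ?posrE ?invr_gt0 ?exprn_gt0 //.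
by apply: lt_trans ne _; rewrite -natrX ltr_nat ltn_expl.
Qed.

Definition level_continuous (T U : tree) (f : branches T -> branches U) :=
  forall n, exists m, forall x y, branch_level x m.+1 = branch_level y m.+1 ->
    branch_level (f x) n.+1 = branch_level (f y) n.+1.

Lemma unif_continuous_branchP (T U : tree) (f : branch_space R T -> branch_space R U) :
  unif_continuous f <-> level_continuous f.
Proof.
rewrite unif_continuousP; split=> [fc n|fc e /exists_pow2_lt[n ne]].
  have e0 : 0 < 2 ^- n :> R by rewrite invr_gt0 exprn_gt0.
  have [d /exists_pow2_lt[m md] fd] := fc _ e0.
  exists m => x y /branch_dist_lt xy; apply/branch_dist_lt.
  apply: (fd (x, y)).
  exact: lt_trans md.
have [m fm] := fc n; exists (2 ^- m); first by rewrite invr_gt0 exprn_gt0.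
move=> [x y] /branch_dist_lt/fm/branch_dist_lt xy.
exact: lt_trans ne.
Qed.

End BranchUniform.

(** * Center and commuting planes of G_T *)

Section GTree.
Local Open Scope group_scope.
Variables (p : nat) (p_prime : prime p) (p_odd : odd p) (T : tree).
Hypothesis (T_pruned : pruned T) (T1 : infinite_set (level T 1)).
Implicit Types (g h z : G_tree p T) (x y : branches T).

Local Notation gcoord g n := (inv_lim_coord g n : L p (level T n.+1)).

Let X2 n := @level_two T T_pruned T1 n.
Let pred_surj n := @level_pred_surj T T_pruned n.

Definition branch_gen (i : branches T + branches T) n : level T n + level T n :=
  match i with
  | inl x => inl (branch_level x n)
  | inr x => inr (branch_level x n)
  end.

Fact G_gen_subproof (i : branches T + branches T) :
  exists g, forall n, gcoord g n = L_gen p (branch_gen i n.+1).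
Proof.
apply: inv_lim_exists => n; rewrite /= L_map_L_gen.
by case: i => x /=; rewrite level_pred_branch.
Qed.

Definition G_gen i : G_tree p T := projT1 (cid (G_gen_subproof i)).

Lemma G_genE i n : gcoord (G_gen i) n = L_gen p (branch_gen i n.+1).
Proof. exact: (projT2 (cid (G_gen_subproof i))). Qed.

Lemma G_central_coordS g n : central (gcoord g n.+1) -> central (gcoord g n).
Proof. by rewrite -[gcoord g n]inv_limP => c; exact: L_map_central. Qed.

Lemma G_central_coordD g n k : central (gcoord g (k + n)) -> central (gcoord g n).
Proof. by elim: k => // k IH /G_central_coordS. Qed.

(** Every node lies on a branch, so each generator of L over level [n.+1] is a coordinate of some
    [G_gen]. *)
Lemma G_centralP g : central g <-> forall n, central (gcoord g n).
Proof.
split=> [cg n|cg h]; last by apply/inv_lim_commute => n; exact: cg.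
apply: L_central_gen => i.
have [j <-] : exists j, branch_gen j n.+1 = i.
  by case: i => v; have [x <-] := branch_extend T_pruned v; [exists (inl x)|exists (inr x)].
by rewrite -G_genE; apply: (inv_lim_commute _ _).1; exact: cg.
Qed.

Definition G_plane_elt x (a b : nat) := G_gen (inl x) ^+ a * G_gen (inr x) ^+ b.

Lemma G_plane_eltE x a b n :
  gcoord (G_plane_elt x a b) n = L_plane_elt p (branch_level x n.+1) a b.
Proof. by rewrite inv_lim_coordM !inv_lim_coordX !G_genE. Qed.

Definition G_plane x g :=
  exists a b z, central z /\ g = G_plane_elt x a b * z.

Lemma G_plane_gen x : G_plane x (G_gen (inl x)) /\ G_plane x (G_gen (inr x)).
Proof.
split; [exists 1%N, 0%N, 1|exists 0%N, 1%N, 1]; rewrite /G_plane_elt ?mulg1 ?mul1g;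
  by split=> //; exact: central1.
Qed.

Lemma G_gen_commute x : commute (G_gen (inl x)) (G_gen (inr x)).
Proof.
by apply/inv_lim_commute => n; rewrite !G_genE; apply/commgP/eqP/L_gen_comm.
Qed.

Lemma G_plane_central x z : central z -> G_plane x z.
Proof. by move=> cz; exists 0%N, 0%N, z; rewrite /G_plane_elt !mul1g. Qed.

Lemma G_planeM x g h : G_plane x g -> G_plane x h -> G_plane x (g * h).
Proof.
move=> [a [b [z [cz ->]]]] [a' [b' [z' [cz' ->]]]].
exists (a + a')%N, (b + b')%N, (z * z'); split; first exact: centralM.
have cab := commuteX2 a' b (G_gen_commute x).
rewrite /G_plane_elt !expgnDr -!mulgA; congr (_ * _).
by rewrite cz -!mulgA -(cz' z) !mulgA cab.
Qed.

Lemma G_planeX x g n : G_plane x g -> G_plane x (g ^+ n).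
Proof.
move=> xg; elim: n => [|n IH]; first exact/G_plane_central/central1.
by rewrite expgS; exact: G_planeM.
Qed.

Lemma G_plane_coord x g n : G_plane x g -> L_plane (branch_level x n.+1) (gcoord g n).
Proof.
move=> [a [b [z [/G_centralP cz ->]]]]; exists a, b, (gcoord z n).
by rewrite inv_lim_coordM G_plane_eltE.
Qed.

(** Centrality in one coordinate already makes both exponents divisible by [p], and then the powers
    are trivial in all coordinates. *)
Lemma G_plane_central_coord x g n :
  G_plane x g -> central (gcoord g n) -> central g.
Proof.
move=> [a [b [z [cz ->]]]]; rewrite inv_lim_coordM G_plane_eltE => c.
have [pa pb] := L_plane_central p_prime p_odd (X2 (n := n)) (((G_centralP z).1 cz) n) c.
have exp1 (h : G_tree p T) k : p %| k -> h ^+ k = 1.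
  move=> pk; apply: inv_lim_inj => m; rewrite inv_lim_coordX.
  exact: L_expg_dvd.
by rewrite /G_plane_elt !exp1 // !mul1g.
Qed.

(** A noncentral plane element is noncentral in every coordinate, so each coordinate identifies its
    node; this turns closeness in the group into closeness of branches. *)
Lemma G_plane_level x y g h n : G_plane x g -> G_plane y h -> ~ central g ->
  gcoord g n = gcoord h n -> branch_level x n.+1 = branch_level y n.+1.
Proof.
move=> xg yh ncg gh; apply: (@L_plane_disjoint p p_prime p_odd _ (X2 (n := n)) _ _ (gcoord g n)).
- exact: G_plane_coord.
- by rewrite gh; exact: G_plane_coord.
- by move/(G_plane_central_coord xg).
Qed.

Lemma G_plane_inj x y g : G_plane x g -> G_plane y g -> ~ central g -> x = y.
Proof. by move=> xg yg ncg; apply: branch_inj => n; exact: (G_plane_level xg yg). Qed.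

(** Coordinate 0 suffices, as it determines the exponents modulo [p]. This supplies the independence
    required by [G_commute_plane]. *)
Lemma G_gen_indep x : ~ central (G_gen (inl x)) /\
  forall n, ~ central (G_gen (inr x) * G_gen (inl x) ^+ n).
Proof.
have indep a b : central (G_plane_elt x a b) -> p %| b /\ p %| a.
  move=> /G_centralP/(_ 0%N); rewrite G_plane_eltE -[L_plane_elt _ _ _ _]mulg1.
  by case/(L_plane_central p_prime p_odd (X2 (n := 0)) (@central1 _)).
have p1 : ~ p %| 1 by rewrite dvdn1 => /eqP p1; move: p_prime; rewrite p1.
split=> [c|n].
  by have [] := indep 1%N 0%N; rewrite /G_plane_elt ?mulg1.
by rewrite -(commuteX2 n 1 (G_gen_commute x)) => /(indep n 1%N)[].
Qed.

(** The exponents may vary with [n], but reduction to coordinate [N] determines them modulo [p], so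
    those found at [N] serve everywhere. *)
Lemma G_planeP N x g :
  (forall n, L_plane (branch_level x (n + N).+1) (gcoord g (n + N))) -> G_plane x g.
Proof.
move=> xg.
have down n a b (z : L p (level T (n + N).+1)) : central z ->
    gcoord g (n + N) = L_plane_elt p (branch_level x (n + N).+1) a b * z ->
    exists2 z', central z' & gcoord g N = L_plane_elt p (branch_level x N.+1) a b * z'.
  elim: n z => [|n IH] z cz gz; first by exists z.
  apply: (IH (L_map (@level_pred T _) z)); first exact: L_map_central.
  rewrite -[LHS]inv_limP [X in L_map _ X = _]gz gmulfM /= L_map_plane_elt.
  by rewrite level_pred_branch.
have [a [b [z [cz gN]]]] := xg 0%N.
exists a, b, ((G_plane_elt x a b)^-1 * g); split; last by rewrite mulVKg.
(* Centrality passes down, so testing the coordinates from [N] on is enough. *)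
apply/G_centralP => n; apply: (@G_central_coordD _ _ N); rewrite addnC.
rewrite inv_lim_coordM inv_lim_coordV G_plane_eltE.
have [a' [b' [z' [cz' gn]]]] := xg n; have [z'' cz'' gN'] := down _ _ _ _ cz' gn.
have ea : (a%:R = a'%:R :> 'F_p)%R.
  rewrite -(L_coord_plane_inl p_prime p_odd (X2 (n := N)) (branch_level x N.+1) a b cz).
  by rewrite -gN [X in L_coord _ X]gN' L_coord_plane_inl.
have eb : (b%:R = b'%:R :> 'F_p)%R.
  rewrite -(L_coord_plane_inr p_prime p_odd (X2 (n := N)) (branch_level x N.+1) a b cz).
  by rewrite -gN [X in L_coord _ X]gN' L_coord_plane_inr.
by rewrite gn /L_plane_elt (L_expg_eq p_prime _ ea) (L_expg_eq p_prime _ eb) mulKg.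
Qed.

(** Far enough up, all coordinates satisfy the hypotheses of [L_commute_plane]; the nodes found
    there form a branch because planes of distinct nodes meet only in the center. *)
Lemma G_commute_plane g h : commute g h -> ~ central g ->
  (forall n, ~ central (h * g ^+ n)) -> exists x, G_plane x g /\ G_plane x h.
Proof.
move=> /inv_lim_commute gh ncg nch.
have ncN (e : G_tree p T) : ~ central e -> exists N, forall n, (N <= n)%N -> ~ central (gcoord e n).
  move=> nce; apply: contrapT => noN; apply: nce; apply/G_centralP => n.
  apply: contrapT => ncn; apply: noN; exists n => m /subnK <- /G_central_coordD.
  exact: ncn.
have [N1 hN1] := ncN _ ncg.
have [N2 hN2] : exists N, forall n, (N <= n)%N ->
    forall k, (k < p)%N -> ~ central (gcoord (h * g ^+ k) n).
  (* Induction on the bound for [k] alone: finitely many exponents occur, so their thresholds have a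
     maximum. *)
  elim: {1}p => [|q [N hN]]; first by exists 0%N.
  have [M hM] := ncN _ (nch q); exists (maxn N M) => n.
  rewrite geq_max => /andP[Nn Mn] k; rewrite ltnS leq_eqVlt => /orP[/eqP->|/(hN n Nn)//].
  exact: hM.
pose N := maxn N1 N2.
have N1P n : (N1 <= n + N)%N by rewrite (leq_trans (leq_maxl N1 N2)) // leq_addl.
have N2P n : (N2 <= n + N)%N by rewrite (leq_trans (leq_maxr N1 N2)) // leq_addl.
have /(_ _)/cid vP n : exists v : level T (n + N).+1,
    L_plane v (gcoord g (n + N)) /\ L_plane v (gcoord h (n + N)).
  apply: (L_commute_plane p_prime p_odd (X2 (n := n + N))); [exact: gh|exact: hN1|].
  move=> k kp; have := hN2 _ (N2P n) _ kp.
  by rewrite inv_lim_coordM inv_lim_coordX.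
pose v n := projT1 (vP n).
have vg n : L_plane (v n) (gcoord g (n + N)) := (projT2 (vP n)).1.
have vh n : L_plane (v n) (gcoord h (n + N)) := (projT2 (vP n)).2.
have [x xv] : exists x, forall n, branch_level x (n + N).+1 = v n.
  (* The planes of [v n] and of the predecessor of [v n.+1] share the noncentral coordinate of
     [g]. *)
  apply: branch_of_levels => n.
  apply: (@L_plane_disjoint p p_prime p_odd _ (X2 (n := n + N)) _ _ (gcoord g (n + N))).
  - by rewrite -[gcoord g (n + N)]inv_limP; apply: L_map_plane => //; exact: vg n.+1.
  - exact: vg.
  - exact: hN1.
by exists x; split; apply: (@G_planeP N) => n; rewrite xv.
Qed.

End GTree.

(** * From group isomorphisms to maps of branches *)

Section IsoToBranches.
Local Open Scope group_scope.
Variables (p : nat) (p_prime : prime p) (p_odd : odd p) (T U : tree).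
Hypotheses (T_pruned : pruned T) (U_pruned : pruned U).
Hypotheses (T1 : infinite_set (level T 1)) (U1 : infinite_set (level U 1)).

(** The commuting independent pair a_x, b_x goes to such a pair, hence into one plane, and the whole
    plane of [x] follows. Continuity of [f] carries agreement of a_x and a_y in one coordinate to
    their images. *)
Lemma iso_plane (f : {multiplicative G_tree p T -> G_tree p U}) f' :
  cancel f f' -> cancel f' f -> continuous f ->
  exists2 phi : branches T -> branches U, level_continuous phi &
    forall x g, G_plane x g -> G_plane (phi x) (f g).
Proof.
move=> fK f'K fc.
pose h : {multiplicative G_tree p U -> G_tree p T} :=
  HB.pack f' (isMultiplicative.Build _ _ f' (can2_gmulfM fK f'K)).
have cf' z : central (f z) -> central z.
  by rewrite -{2}[z]fK; exact: (@central_morph _ _ h f).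
have /choice[phi phiP] : forall x : branches T, exists y : branches U,
    forall g, G_plane x g -> G_plane y (f g).
  move=> x; have [nca ncb] := G_gen_indep p_prime p_odd T_pruned T1 x.
  have [y [ya yb]] : exists y, G_plane y (f (G_gen p (inl x))) /\
                               G_plane y (f (G_gen p (inr x))).
    apply: G_commute_plane => //; first exact/gmulf_commute/G_gen_commute.
      by move/cf'.
    by move=> n; rewrite -multiplicativeX -gmulfM => /cf'; exact: ncb.
  exists y => _ [a [b [z [cz ->]]]]; rewrite /G_plane_elt !gmulfM !multiplicativeX.
  do !apply: G_planeM; try exact: G_planeX.
  by apply: G_plane_central; exact: central_morph cz.
exists phi => // n; have [m fm] := inv_lim_continuous_coord fc n; exists m => x y xy.
have xa x' := phiP x' _ (G_plane_gen p x').1.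
apply: (G_plane_level p_prime p_odd U_pruned U1 (xa x) (xa y)).
  by move/cf'; exact: (G_gen_indep p_prime p_odd T_pruned T1 x).1.
by apply: fm; rewrite !G_genE /= xy.
Qed.

End IsoToBranches.

(** The noncentral a_x lies in the planes of both [x] and [psi (phi x)], so these branches are
    equal; likewise on the other side. *)
Lemma iso_branch_homeo (p : nat) (T U : tree) :
    prime p -> odd p -> pruned T -> pruned U ->
    infinite_set (level T 1) -> infinite_set (level U 1) ->
    topologically_isomorphic (G_tree p T) (G_tree p U) ->
  exists (phi : branches T -> branches U) (psi : branches U -> branches T),
    [/\ cancel phi psi, cancel psi phi, level_continuous phi & level_continuous psi].
Proof.
move=> p_prime p_odd Tp Up T1 U1 [f [f' [fK f'K fc f'c]]].
pose h : {multiplicative G_tree p U -> G_tree p T} :=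
  HB.pack f' (isMultiplicative.Build _ _ f' (can2_gmulfM fK f'K)).
have [phi phic phiP] := iso_plane p_prime p_odd Tp Up T1 U1 fK f'K fc.
have [psi psic psiP] := @iso_plane _ p_prime p_odd _ _ Up Tp U1 T1 h f f'K fK f'c.
exists phi, psi; split=> // x.
  have xa := (G_plane_gen p x).1; apply/esym.
  apply: (G_plane_inj p_prime p_odd Tp T1 xa).
    by rewrite -[G_gen _ _]fK; apply/psiP/phiP.
  exact: (G_gen_indep p_prime p_odd Tp T1 x).1.
have xa := (G_plane_gen p x).1; apply/esym.
apply: (G_plane_inj p_prime p_odd Up U1 xa).
  by rewrite -[G_gen _ _]f'K; apply/phiP/psiP.
exact: (G_gen_indep p_prime p_odd Up U1 x).1.
Qed.

(** * The homomorphism induced by a uniformly continuous map *)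

Section InducedMap.
Variables (p : nat) (T U : tree) (T_pruned : pruned T).
Variable phi : branches T -> branches U.

Definition level_extend n (v : level T n.+1) : branches T :=
  projT1 (cid (branch_extend T_pruned v)).

Lemma level_extendK n (v : level T n.+1) : branch_level (level_extend v) n.+1 = v.
Proof. exact: (projT2 (cid (branch_extend T_pruned v))). Qed.

(* Depends on the choice of extension unless [k] is a modulus for [n]. *)
Definition level_map n k (v : level T k.+1) : level U n.+1 :=
  branch_level (phi (level_extend v)) n.+1.

Definition is_modulus n m :=
  forall x y, branch_level x m.+1 = branch_level y m.+1 ->
    branch_level (phi x) n.+1 = branch_level (phi y) n.+1.

Lemma level_map_branch n m k x : is_modulus n m -> (m <= k)%N ->
  level_map n (branch_level x k.+1) = branch_level (phi x) n.+1.
Proof.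
move=> nm mk; apply: nm; apply: (@branch_level_le _ _ _ _ k.+1) => //.
exact: level_extendK.
Qed.

(** Raising [k] by one composes the node map with the predecessor map, which also links the two
    coordinates of [g]. *)
Lemma L_map_level_map n m k (g : G_tree p T) : is_modulus n m -> (m <= k)%N ->
  L_map (@level_map n k) (inv_lim_coord g k) =
  L_map (@level_map n m) (inv_lim_coord g m).
Proof.
move=> nm /subnK <-; elim: (k - _)%N => [//|{}k <-].
rewrite -[inv_lim_coord g (k + m)]inv_limP /= L_map_comp.
congr (L_map _ _); apply/funext => v /=.
by rewrite -{2}(level_extendK v) level_pred_branch (level_map_branch _ nm) ?leq_addl.
Qed.

Hypothesis phic : level_continuous phi.

Definition modulus n := projT1 (cid (phic n)).

Lemma modulusP n : is_modulus n (modulus n).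
Proof. exact: (projT2 (cid (phic n))). Qed.

Definition G_map_coord (g : G_tree p T) n : L p (level U n.+1) :=
  L_map (@level_map n (modulus n)) (inv_lim_coord g (modulus n)).

Lemma G_map_coordE g n k : (modulus n <= k)%N ->
  G_map_coord g n = L_map (@level_map n k) (inv_lim_coord g k).
Proof. by move=> nk; apply/esym/L_map_level_map => //; exact: modulusP. Qed.

Fact G_map_subproof g : exists h : G_tree p U, forall n, inv_lim_coord h n = G_map_coord g n.
Proof.
apply: inv_lim_exists => n.
(* Coordinates [n] and [n.+1] are both computed from the coordinate of [g] at the larger modulus. *)
rewrite (G_map_coordE g (leq_maxl (modulus n) (modulus n.+1))).
rewrite (G_map_coordE g (leq_maxr (modulus n) (modulus n.+1))) /= L_map_comp.
by congr (L_map _ _); apply/funext => v; exact: level_pred_branch.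
Qed.

Definition G_map g : G_tree p U := projT1 (cid (G_map_subproof g)).

Lemma G_mapE g n : inv_lim_coord (G_map g) n = G_map_coord g n.
Proof. exact: (projT2 (cid (G_map_subproof g))). Qed.

Lemma G_mapM : {morph G_map : g h / (g * h)%g}.
Proof.
move=> g h; apply: inv_lim_inj => n.
by rewrite inv_lim_coordM !G_mapE /G_map_coord inv_lim_coordM gmulfM.
Qed.

Lemma G_map_continuous : continuous G_map.
Proof.
move=> g; apply: inv_lim_cvg => n; apply: filterS (inv_lim_coord_near g (modulus n)).
by move=> h e; rewrite !G_mapE /G_map_coord e.
Qed.

End InducedMap.

(** The composite and the identity are both induced from one common level, high enough for both,
    where they are compared on nodes. *)
Lemma G_mapK (p : nat) (T U : tree) (Tp : pruned T) (Up : pruned U)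
    (phi : branches T -> branches U) (psi : branches U -> branches T)
    (phic : level_continuous phi) (psic : level_continuous psi) :
  cancel phi psi -> cancel (@G_map p T U Tp phi phic) (@G_map p U T Up psi psic).
Proof.
move=> phiK g; apply: inv_lim_inj => n.
rewrite G_mapE /G_map_coord G_mapE; set m := modulus psic n.
have km := leq_maxl (modulus phic m) n; have kn := leq_maxr (modulus phic m) n.
rewrite (G_map_coordE _ _ km) L_map_comp.
have idn : is_modulus (@id (branches T)) n n by [].
(* Writing the identity as the map induced by [id], with modulus [n] for [n], lets it be moved up to
   the common level. *)
have coord_n : L_map (level_map (k := n) Tp id n) (inv_lim_coord g n) = inv_lim_coord g n.
  rewrite -[RHS]L_map_id; congr (L_map _ _); apply/funext => v; exact: level_extendK.
rewrite -[RHS]coord_n -(L_map_level_map Tp g idn kn).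
congr (L_map _ _); apply/funext => v.
by rewrite /= (level_map_branch _ _ (@modulusP _ _ _ psic n)) // phiK.
Qed.

Theorem theorem4p8 (R : realType) (p : nat) (p_prime : prime p) (p_odd : odd p)
    (T U : tree) (T_pruned : pruned T) (U_pruned : pruned U)
    (T1_infinite : infinite_set (level T 1))
    (U1_infinite : infinite_set (level U 1)) :
  uniformly_homeomorphic (branch_space R T) (branch_space R U) <->
  topologically_isomorphic (G_tree p T) (G_tree p U).
Proof.
split=> [[phi [psi [phiK psiK]]]|].
  move=> /unif_continuous_branchP phic /unif_continuous_branchP psic.
  pose f : {multiplicative G_tree p T -> G_tree p U} :=
    HB.pack (G_map T_pruned phic)
      (isMultiplicative.Build _ _ _ (@G_mapM p _ _ T_pruned _ phic)).
  exists f, (G_map U_pruned psic).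
  by split; [exact: G_mapK|exact: G_mapK|exact: G_map_continuous|exact: G_map_continuous].
move=> /(iso_branch_homeo p_prime p_odd T_pruned U_pruned T1_infinite U1_infinite).
move=> [phi [psi [phiK psiK phic psic]]]; exists phi, psi.
by split=> //; exact/unif_continuous_branchP.
Qed.
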